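(* Let $G=(V(G),E(G))$ be an arbitrary graph with $|V(G)|=n$, and let $k$ be a positive integer. (i) If $k=n$, then $\gamma_{k\text{-SRD}}(G)=n$. (ii) If $k<n$, then $\gamma_{k\text{-SRD}}(G)\geqslant k+1$.
   Context: All graphs are finite, simple and undirected; $N(v)$ denotes the set of neighbors of $v$ and $\Delta(G)$ the maximum degree. Let $k\geqslant 1$ be an integer with $|V(G)|\geqslant k$. An attack pattern is a set $P\subseteq V(G)$ with $|P|=k$. A function $f:V(G)\to\{0,1,\ldots,\min(\Delta(G),k)+1\}$ is a proper $k$-SRD ($k$-strong Roman domination) function if for each attack pattern $P$ every vertex $u\in P$ with $f(u)=0$ can be defended by a neighboring vertex, where each vertex $v$ with $f(v)\geqslant 2$ can defend at most $f(v)-1$ of its neighbors in $P$ labeled 0 (and vertices with label $\leqslant 1$ defend no other vertex). That is, for each $P$ there is a map $\delta_P:\{u\in P : f(u)=0\}\to V(G)$ (which may depend on $P$) such that $\delta_P(u)\in N(u)$ and $f(\delta_P(u))\geqslant 2$ for all $u$ in its domain, and $|\delta_P^{-1}(v)|\leqslant f(v)-1$ for every $v$ with $f(v)\geqslant 2$. The weight is $\omega(f)=\sum_{v\in V(G)}f(v)$, and the $k$-SRD number is $\gamma_{k\text{-SRD}}(G)=\min\{\omega(f) : f \text{ is a proper } k\text{-SRD function on } G\}$. *)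

(* Defs.v *)
From mathcomp Require Import all_boot.

Set Implicit Arguments.
Unset Strict Implicit.
Unset Printing Implicit Defensive.

(* A finite simple graph is a symmetric irreflexive adjacency relation [e] on  *)
(* a finite vertex type [T]; the definitions below do not use these two        *)
(* properties, so they are left as hypotheses of the theorems.                 *)
Section StrongRomanDomination.

Variables (T : finType) (e : rel T).

Definition neighbors (v : T) : {set T} := [set u | e v u].

Definition maxdeg : nat := \max_(v : T) #|neighbors v|.

Variable k : nat.

(* 'I_m.+2 = {0, ..., m + 1} *)
Definition labeling := {ffun T -> 'I_(minn maxdeg k).+2}.

Implicit Type f : labeling.

Definition weight f : nat := \sum_(v : T) f v.

Definition attacked_zeros f (P : {set T}) : {set T} :=
  [set u in P | f u == 0 :> nat].

(* [d] is a total function, but only its values on [attacked_zeros f P] are    *)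
(* constrained, and only those are counted in the fibre over [v].              *)
Definition defends f (P : {set T}) (d : {ffun T -> T}) : bool :=
  [forall u in attacked_zeros f P, (d u \in neighbors u) && (2 <= f (d u))]
  && [forall (v | 2 <= f v),
        #|[set u in attacked_zeros f P | d u == v]| <= f v - 1].

Definition proper_SRD f : bool :=
  [forall (P : {set T} | #|P| == k), exists d : {ffun T -> T}, defends f P d].

Definition SRD_weight (w : nat) : bool :=
  [exists f : labeling, proper_SRD f && (weight f == w)].

Lemma SRD_weight_ex : exists w, SRD_weight w.
Proof.
pose f : labeling := [ffun=> inord 1].
have f1 v : f v = 1 :> nat by rewrite ffunE inordK.
exists (weight f); apply/existsP; exists f; rewrite eqxx andbT.
apply/forall_inP => P _; apply/existsP; exists [ffun u => u].
apply/andP; split; apply/forall_inP => u; last by rewrite f1.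
by rewrite inE f1 andbF.
Qed.

Definition SRD_number : nat := ex_minn SRD_weight_ex.

End StrongRomanDomination.

(* Main.v *)
Require Import Defs.
From mathcomp Require Import all_boot.

(** Counting zeros by their defenders, an attack [P] contains at most as many
    zeros as the excess of [f], the sum of [f v - 1] over the vertices of
    positive label.  So the weight is at least the number of zeros in [P] plus
    the number of positive vertices.  Attack all zeros if there are at most [k]
    of them, and otherwise only zeros: the weight is then at least [k], hence
    nonzero, so some vertex is positive. *)

(** Pad [A] with [k - #|A|] elements of [B :\: A]. This supplies attacks of size exactly [k] that
    contain all zeros, or only zeros. *)
Lemma set_between_card {T : finType} {A B : {set T}} {k : nat} :
  A \subset B -> #|A| <= k <= #|B| ->
  exists P : {set T}, [/\ A \subset P, P \subset B & #|P| = k].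
Proof.
move=> sAB /andP[leAk lekB].
have /card_geqP[s [s_uniq s_size sD]] : k - #|A| <= #|B :\: A|.
  by rewrite cardsD (setIidPr sAB) leq_sub2r.
have : [set x in s] \subset B :\: A by apply/subsetP => x; rewrite inE => /sD.
rewrite subsetD => /andP[ssB dsA].
exists (A :|: [set x in s]); split; first exact: subsetUl.
  by rewrite subUset sAB.
by rewrite cardsU setIC disjoint_setI0 // cards0 subn0 cardsE
           (card_uniqP s_uniq) s_size subnKC.
Qed.

Section LowerBound.

Context {T : finType} {e : rel T} {k : nat}.
Implicit Types (f : labeling e k) (P : {set T}).

Definition zeros f : {set T} := [set v | f v == 0 :> nat].

Lemma weight_excess f :
  weight f = #|~: zeros f| + \sum_(v in ~: zeros f) (f v - 1).
Proof.
rewrite -sum1_card -big_split /weight [LHS](bigID (mem (zeros f))) /=.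
rewrite big1 => [|v].
  rewrite add0n; apply: eq_big => v; first by rewrite !inE.
  by rewrite inE -lt0n => fv; rewrite subnKC.
by rewrite inE => /eqP.
Qed.

Lemma card_attacked_zeros f P (d : {ffun T -> T}) : defends f P d ->
  #|attacked_zeros f P| <= \sum_(v in ~: zeros f) (f v - 1).
Proof.
case/andP => /forall_inP d_def /forall_inP d_cap.
rewrite -sum1_card (partition_big d (mem (~: zeros f))) => [|u /d_def/andP[_]].
  apply: leq_sum => v; rewrite !inE => fv_neq0.
  have [fv_ge2|fv_lt2] := leqP 2 (f v).
    by apply: leq_trans (d_cap v fv_ge2); rewrite -sum1_card;
       apply/eq_leq/eq_bigl => u; rewrite !inE.
  (* Here [f v] is 1, so the excess is 0; the fibre over [v] is empty because every defender has
     label at least 2. *)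
  rewrite big_pred0 // => u; apply/negP => /andP[/d_def/andP[_ fdu] /eqP du].
  by rewrite du leqNgt fv_lt2 in fdu.
by rewrite !inE => fdu; rewrite -lt0n (leq_trans _ fdu).
Qed.

Lemma proper_weight_ge f P : proper_SRD f -> #|P| = k ->
  #|~: zeros f| + #|P :&: zeros f| <= weight f.
Proof.
move=> /forall_inP f_proper cardP.
have /existsP[d /card_attacked_zeros] := f_proper P (introT eqP cardP).
rewrite weight_excess leq_add2l; apply: leq_trans.
by apply/eq_leq/eq_card => v; rewrite !inE.
Qed.

Lemma proper_weight_ge_card f : proper_SRD f -> #|zeros f| <= k <= #|T| ->
  #|T| <= weight f.
Proof.
rewrite -[#|T|]cardsT => f_proper le_k.
have [P [sZP _ cardP]] := set_between_card (subsetT (zeros f)) le_k.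
apply: leq_trans (proper_weight_ge f P f_proper cardP).
by rewrite (setIidPr sZP) cardsT -(cardsC (zeros f)) addnC.
Qed.

Lemma proper_weight_gt f : 0 < k -> proper_SRD f -> k <= #|zeros f| ->
  k < weight f.
Proof.
move=> k_gt0 f_proper le_k.
have [|P [_ sPZ cardP]] := set_between_card (k := k) (sub0set (zeros f)).
  by rewrite cards0.
have := proper_weight_ge f P f_proper cardP.
rewrite (setIidPl sPZ) cardP; apply: leq_trans.
(* One positive vertex is enough. With none, both terms of [weight_excess] vanish, although the
   weight is at least [k > 0]. *)
rewrite -addn1 addnC leq_add2r card_gt0; apply/eqP => pos0.
have := proper_weight_ge f P f_proper cardP.
by rewrite weight_excess pos0 big_set0 cards0 (setIidPl sPZ) cardP leqNgt k_gt0.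
Qed.

End LowerBound.

Lemma SRD_number_le_card (T : finType) (e : rel T) (k : nat) :
  SRD_number e k <= #|T|.
Proof.
rewrite /SRD_number; case: ex_minnP => w _; apply.
(* With all labels 1 no attacked vertex needs a defender, so any [d] serves. The label 1 is always
   in range, so [inord] does not fall back to its default. *)
pose f : labeling e k := [ffun=> inord 1].
have f1 v : f v = 1 :> nat by rewrite ffunE inordK.
apply/existsP; exists f; apply/andP; split.
  apply/forall_inP => P _; apply/existsP; exists [ffun u => u].
  apply/andP; split; apply/forall_inP => u; last by rewrite f1.
  by rewrite inE f1 andbF.
by rewrite -sum1_card; apply/eqP/eq_bigr.
Qed.

Theorem theorem2 (T : finType) (e : rel T)
  (e_sym : symmetric e) (e_irr : irreflexive e)
  (n k : nat) (card_T : #|T| = n) (k_gt0 : 0 < k) :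
  (k = n -> SRD_number e k = n) /\
  (k < n -> k + 1 <= SRD_number e k).
Proof.
have [f f_proper f_min] :
    exists2 f : labeling e k, proper_SRD f & weight f = SRD_number e k.
  rewrite /SRD_number; case: ex_minnP => w + _.
  by case/existsP => f /andP[f_proper /eqP fw]; exists f.
rewrite -card_T -f_min addn1; split=> [k_n|lt_kn].
  apply/eqP; rewrite eqn_leq {1}f_min SRD_number_le_card /=.
  apply: proper_weight_ge_card => //.
  by apply/andP; split; first apply: leq_trans (max_card _) _; rewrite k_n.
(* With fewer than [k] zeros, one attack covers them all and the weight is at least [#|T|], which
   exceeds [k]. *)
have [le_kz|lt_zk] := leqP k #|zeros f|; first exact: proper_weight_gt.
by apply: (leq_trans lt_kn); apply: proper_weight_ge_card => //;
   rewrite (ltnW lt_zk) (ltnW lt_kn).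
Qed.
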